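(* For every integer $\lambda\geq 3$ and every constant $\beta\in(0,1]$ there is a constant $\theta=\theta(\lambda,\beta)>0$ such that the following holds. Let $S\subseteq\{0,1\}^n$ be a cube-ideal set-system with connectivity $\lambda$, and let $F$ be the minimal face of $\mathrm{conv}(S)$ containing some point $x\in\mathbb{R}^n$ with $x_i\in\{\tfrac1\lambda,1-\tfrac1\lambda\}$ for each $i\in[n]$. If $F$ has dimension at least $\beta n$, then $|S\cap F|\geq e^{\theta n}$.
   Context: A set-system is a subset $S\subseteq\{0,1\}^n$; $\mathrm{conv}(S)$ denotes its convex hull. A capacity inequality is one of $x_i\geq 0$ or $x_i\leq 1$. A generalized set covering (GSC) inequality is an inequality $\sum_{i\in I}x_i+\sum_{j\in J}(1-x_j)\geq 1$ for disjoint $I,J\subseteq[n]$; it uses $|I|+|J|$ variables. $S$ is cube-ideal if $\mathrm{conv}(S)$ equals the set of points of $\mathbb{R}^n$ satisfying some finite family of capacity and GSC inequalities. The connectivity of $S$ is the minimum number of variables used in a GSC inequality valid for $\mathrm{conv}(S)$ ($+\infty$ if $S=\{0,1\}^n$). *)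

(* Defs.v *)
From HB Require Import structures.
From mathcomp Require Import all_boot all_order all_algebra.
From mathcomp Require Import all_classical all_reals all_analysis.

Set Implicit Arguments.
Unset Strict Implicit.
Unset Printing Implicit Defensive.

Import Order.TTheory GRing.Theory Num.Theory.

Local Open Scope classical_set_scope.
Local Open Scope ring_scope.

(* A set-system is S : {set 'rV[bool]_n}; 0/1 vectors are embedded in R^n. *)
Definition cube_point (R : realType) (n : nat) (s : 'rV[bool]_n) : 'rV[R]_n :=
  \row_i (s 0 i)%:R.

Definition conv_hull (R : realType) (n : nat) (S : {set 'rV[bool]_n}) :
    set 'rV[R]_n :=
  [set x | exists w : 'rV[bool]_n -> R,
    [/\ forall s, s \in S -> 0 <= w s,
        \sum_(s in S) w s = 1 &
        x = \sum_(s in S) w s *: cube_point R s]].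
Arguments conv_hull R {n} S.

Definition gsc_holds (R : realType) (n : nat) (I J : {set 'I_n})
    (x : 'rV[R]_n) : Prop :=
  1 <= \sum_(i in I) x 0 i + \sum_(j in J) (1 - x 0 j).

Inductive cube_ineq (n : nat) : Type :=
  | CapLower of 'I_n
  | CapUpper of 'I_n
  | Gsc (I J : {set 'I_n}) of [disjoint I & J]%B.

Definition cube_ineq_holds (R : realType) (n : nat) (e : cube_ineq n)
    (x : 'rV[R]_n) : Prop :=
  match e with
  | CapLower i => 0 <= x 0 i
  | CapUpper i => x 0 i <= 1
  | Gsc I0 J0 _ => gsc_holds I0 J0 x
  end.

Definition cube_ideal (R : realType) (n : nat) (S : {set 'rV[bool]_n}) : Prop :=
  exists (m : nat) (e : 'I_m -> cube_ineq n),
    conv_hull R S = [set x | forall k, cube_ineq_holds (e k) x].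

Definition gsc_valid (R : realType) (n : nat) (S : {set 'rV[bool]_n})
    (I J : {set 'I_n}) : Prop :=
  forall x : 'rV[R]_n, conv_hull R S x -> gsc_holds I J x.

(* The minimum over the empty family is +oo. *)
Definition connectivity (R : realType) (n : nat) (S : {set 'rV[bool]_n}) :
    \bar R :=
  \big[Order.min/+oo%E]_(IJ : {set 'I_n} * {set 'I_n} |
      [disjoint IJ.1 & IJ.2]%B && `[< gsc_valid R S IJ.1 IJ.2 >])
    ((#|IJ.1| + #|IJ.2|)%N%:R)%:E.

(* Faces are cut out by valid inequalities <c, y> >= d; P itself (c = 0, d = 0)
   and the empty set (c = 0, d = -1) are faces. *)
Definition is_face (R : realType) (n : nat) (P F : set 'rV[R]_n) : Prop :=
  exists (c : 'rV[R]_n) (d : R),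
    (forall y, P y -> d <= \sum_i c 0 i * y 0 i) /\
    F = [set y | P y /\ \sum_i c 0 i * y 0 i = d].

Definition is_minimal_face_containing (R : realType) (n : nat)
    (P : set 'rV[R]_n) (x : 'rV[R]_n) (F : set 'rV[R]_n) : Prop :=
  [/\ is_face P F, F x &
      forall G, is_face P G -> G x -> G `<=` F -> G = F].

Definition affinely_independent (R : realType) (n k : nat)
    (p : 'I_k -> 'rV[R]_n) : Prop :=
  forall c : 'I_k -> R,
    \sum_i c i = 0 -> \sum_i c i *: p i = 0 -> forall i, c i = 0.

(* The largest k such that A contains k + 1 affinely independent points; in R^n
   this forces k <= n. By convention the value is 0 (not -1) on the empty set. *)
Definition affine_dim (R : realType) (n : nat) (A : set 'rV[R]_n) : nat :=
  \max_(k < n.+1 | `[< exists p : 'I_k.+1 -> 'rV[R]_n,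
      (forall i, A (p i)) /\ affinely_independent p >]) k.

(* Main.v *)
Require Import Defs.
From HB Require Import structures.
From mathcomp Require Import all_boot all_order all_algebra.
From mathcomp Require Import all_classical all_reals all_analysis.
From mathcomp Require Import zify ring lra.

Set Implicit Arguments.
Unset Strict Implicit.
Unset Printing Implicit Defensive.

Import Order.TTheory GRing.Theory Num.Theory.
Import numFieldNormedType.Exports.

Local Open Scope classical_set_scope.
Local Open Scope ring_scope.

(* A valid GSC inequality is either tight at x or has slack at x at least
   rho := 1 / (lambda (lambda + 1)) per variable. The face F therefore contains
   x + rho l for every direction l of F with coordinates in [-1, 1], so some
   vertex v of F satisfies <l, v - x> >= rho |l|^2.

   Few vertices cannot support all these directions. Minimise
   sum_v expR (eta <l, v - x> - C |l|^2) over the directions l of F in [-1, 1]^n.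
   If fewer than half of dim F coordinates of the minimiser l were +1 or -1, then
   l could be moved both ways along a subspace of dimension over dim F / 2, in
   which some e makes the second-order gain from the vertices smaller than the
   penalty C |e|^2, contradicting minimality. Hence |l|^2 >= dim F / 2, while every
   term of the sum is at most its value |S cap F| at l = 0; the vertex supporting l
   then gives |S cap F| >= expR ((eta rho - C) |l|^2). *)

Definition dot (R : pzRingType) (n : nat) (u v : 'rV[R]_n) : R :=
  \sum_i u 0 i * v 0 i.

Section DotRing.
Variables (R : comPzRingType) (n : nat).
Implicit Types u v w : 'rV[R]_n.

Lemma dot_mulmx u v : dot u v = (u *m v^T) 0 0.
Proof. by rewrite mxE; apply: eq_bigr => i _; rewrite mxE. Qed.

Lemma dotC u v : dot u v = dot v u.
Proof. by apply: eq_bigr => i _; rewrite mulrC. Qed.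

Lemma dotDr u v w : dot u (v + w) = dot u v + dot u w.
Proof. by rewrite !dot_mulmx linearD mulmxDr mxE. Qed.

Lemma dotZr a u v : dot u (a *: v) = a * dot u v.
Proof. by rewrite !dot_mulmx linearZ -scalemxAr mxE. Qed.

Lemma dotNr u v : dot u (- v) = - dot u v.
Proof. by rewrite -scaleN1r dotZr mulN1r. Qed.

Lemma dotBr u v w : dot u (v - w) = dot u v - dot u w.
Proof. by rewrite dotDr dotNr. Qed.

Lemma dotDl u v w : dot (u + v) w = dot u w + dot v w.
Proof. by rewrite dotC dotDr !(dotC w). Qed.

Lemma dotZl a u v : dot (a *: u) v = a * dot u v.
Proof. by rewrite dotC dotZr dotC. Qed.

Lemma dotBl u v w : dot (u - v) w = dot u w - dot v w.
Proof. by rewrite dotC dotBr !(dotC w). Qed.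

Lemma dot0l u : dot 0 u = 0.
Proof. by rewrite -(scale0r u) dotZl mul0r. Qed.

Lemma dot_lincombr (I : Type) (r : seq I) (P : pred I) u (a : I -> R)
    (F : I -> 'rV[R]_n) :
  dot u (\sum_(k <- r | P k) a k *: F k) = \sum_(k <- r | P k) a k * dot u (F k).
Proof.
rewrite (big_morph (dot u) (dotDr u) (id1 := 0)) ?[dot u 0]dotC ?dot0l //.
by apply: eq_bigr => k _; rewrite dotZr.
Qed.

End DotRing.

Section DotReal.
Variables (R : realDomainType) (n : nat).
Implicit Types u v : 'rV[R]_n.

Lemma dot_self_ge0 u : 0 <= dot u u.
Proof. by apply: sumr_ge0 => i _; rewrite -expr2 sqr_ge0. Qed.

Lemma dot_self_gt0 u : (0 < dot u u) = (u != 0).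
Proof.
rewrite lt_def dot_self_ge0 andbT; congr negb.
apply/eqP/eqP => [uu0|->]; last exact: dot0l.
apply/rowP => i; apply/eqP; rewrite mxE -sqrf_eq0 expr2; apply/eqP.
by apply: psumr_eq0P uu0 i isT => i _; rewrite -expr2 sqr_ge0.
Qed.

Lemma dot_selfB_le u v : dot (u - v) (u - v) <= 2 * dot u u + 2 * dot v v.
Proof.
rewrite !mulr_sumr -big_split /=; apply: ler_sum => i _; rewrite !mxE.
have := sqr_ge0 (u 0 i + v 0 i); nra.
Qed.

Lemma dot_self_le_dim u : (forall i, `|u 0 i| <= 1) -> dot u u <= n%:R.
Proof.
move=> u1; rewrite -[n in leRHS]card_ord -sumr_const; apply: ler_sum => i _.
by rewrite -expr2 -real_normK ?num_real // expr_le1.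
Qed.

Lemma card_le_dot_self u (T : {set 'I_n}) :
  (forall i, i \in T -> `|u 0 i| = 1) -> #|T|%:R <= dot u u.
Proof.
move=> uT; rewrite -sumr_const big_mkcond /=; apply: ler_sum => i _.
rewrite -expr2 -real_normK ?num_real //.
by case: ifP => [/uT ->|_]; rewrite ?expr1n ?sqr_ge0.
Qed.

End DotReal.

Lemma mxrank_leq_cap_kermx (F : fieldType) (m n p : nat) (B : 'M[F]_(m, n))
    (C : 'M[F]_(n, p)) :
  (\rank B <= \rank (B :&: kermx C)%MS + p)%N.
Proof. by rewrite -(mxrank_mul_ker B C) addnC leq_add2l rank_leq_col. Qed.

Section OrthogonalPart.
Variables (R : realFieldType) (n : nat).
Implicit Types e z : 'rV[R]_n.

Definition orthogonal_part e z := z - (dot e z / dot e e) *: e.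

Lemma dot_self_orthogonal_part e z : e != 0 ->
  dot (orthogonal_part e z) (orthogonal_part e z) = dot z z - dot e z ^+ 2 / dot e e.
Proof.
rewrite -dot_self_gt0 => ee_gt0.
rewrite !(dotBl, dotBr, dotZl, dotZr) (dotC z e).
by field; rewrite gt_eqF.
Qed.

Lemma dot_orthogonal_part e e' z :
  dot e' e = 0 -> dot e' (orthogonal_part e z) = dot e' z.
Proof. by move=> e'e; rewrite dotBr dotZr e'e mulr0 subr0. Qed.

End OrthogonalPart.

(* If the first vector tried is bad, removing its direction from all the z's takes
   away more than a [1 / k] share of their energy, and induction applies to what
   remains. *)
Lemma exists_direction_le_trace (R : realFieldType) (n : nat) (I : finType)
    (A : {set I}) (p : I -> R) (z : I -> 'rV[R]_n) (k m : nat) (B : 'M[R]_(m, n)) :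
  (forall a, a \in A -> 0 <= p a) -> (0 < k <= \rank B)%N ->
  exists e : 'rV[R]_n, [/\ (e <= B)%MS, e != 0 &
    k%:R * \sum_(a in A) p a * dot e (z a) ^+ 2 <=
      dot e e * \sum_(a in A) p a * dot (z a) (z a)].
Proof.
move=> p_ge0; elim: k m B z => // k IH m B z /= kB.
set Q := fun e => \sum_(a in A) p a * dot e (z a) ^+ 2.
set E := \sum_(a in A) p a * dot (z a) (z a).
have [e eB e_neq0] : exists2 e : 'rV[R]_n, (e <= B)%MS & e != 0.
  by apply/rowV0Pn; rewrite -mxrank_eq0 -lt0n (leq_trans _ kB).
have ee_gt0 : 0 < dot e e by rewrite dot_self_gt0.
have [small|big] := lerP (k.+1%:R * Q e) (dot e e * E); first by exists e.
pose z' a := orthogonal_part e (z a).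
have E'E : \sum_(a in A) p a * dot (z' a) (z' a) = E - Q e / dot e e.
  rewrite mulr_suml -sumrB; apply: eq_bigr => a _.
  by rewrite dot_self_orthogonal_part // mulrBr mulrA.
set E' := \sum_(a in A) _ in E'E.
have E'_small : k.+1%:R * E' < k%:R * E.
  rewrite E'E -natr1.
  have : E < (k%:R + 1) * (Q e / dot e e).
    by rewrite natr1 mulrA ltr_pdivlMr // mulrC.
  lra.
have [k0|k_gt0] := posnP k.
  suff : 0 <= E' by move: E'_small; rewrite k0; lra.
  by apply: sumr_ge0 => a aA; rewrite mulr_ge0 ?p_ge0 ?dot_self_ge0.
have [|e' [e'B' e'_neq0 e'_small]] := IH _ (B :&: kermx e^T)%MS z'.
  rewrite k_gt0 /= -ltnS (leq_trans kB) // -addn1.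
  exact: mxrank_leq_cap_kermx.
have /andP[e'B /sub_kermxP e'e] : (e' <= B)%MS && (e' <= kermx e^T)%MS.
  by rewrite -sub_capmx.
exists e'; split=> //.
have Q'E : \sum_(a in A) p a * dot e' (z' a) ^+ 2 = Q e'.
  apply: eq_bigr => a _.
  by rewrite dot_orthogonal_part // dot_mulmx e'e mxE.
rewrite Q'E -/E' in e'_small.
rewrite -(ler_pM2l (_ : 0 < k%:R :> R)) ?ltr0n //.
rewrite mulrCA (le_trans (ler_wpM2l _ e'_small)) ?ler0n //.
have := ler_wpM2l (dot_self_ge0 e') (ltW E'_small); lra.
Qed.

Section CubeSection.
Variables (R : realType) (n : nat).
Implicit Types (l v : 'rV[R]_n).

Lemma continuous_dot (T : topologicalType) (f g : T -> 'rV[R]_n) :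
  continuous f -> continuous g -> continuous (fun t => dot (f t) (g t)).
Proof.
move=> fC gC; apply: continuous_big => [x|i _ t]; first exact: add_continuous.
have coordC (h : T -> 'rV[R]_n) :
    continuous h -> {for t, continuous (fun x => h x 0 i)}.
  move=> hC; apply: (@continuous_comp _ _ _ h (fun v => v 0 i) t (hC t)).
  exact: coord_continuous.
by apply: continuousM; exact: coordC.
Qed.

Lemma closed_row_space (m : nat) (B : 'M[R]_(m, n)) :
  closed [set l : 'rV[R]_n | (l <= B)%MS].
Proof.
have -> : [set l : 'rV[R]_n | (l <= B)%MS] =
    \bigcap_(j in [set: 'I_n]) [set l | dot l (col j (cokermx B))^T = 0].
  have dot_col l j : dot l (col j (cokermx B))^T = (l *m cokermx B) 0 j.
    by rewrite mxE; apply: eq_bigr => k _; rewrite !mxE.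
  apply/seteqP; split=> l /=.
    by rewrite submxE => /eqP lB j _; rewrite /= dot_col lB mxE.
  move=> lB; rewrite submxE; apply/eqP/rowP => j.
  by rewrite -dot_col lB // mxE.
apply: closed_bigI => j _.
by apply: (preimage_closed _ (@closed_eq _ _)) => l _;
  apply: continuous_dot => [?|]; [exact: cvg_id | exact: cst_continuous].
Qed.

Definition cube_section (m : nat) (B : 'M[R]_(m, n)) : set 'rV[R]_n :=
  [set l | (l <= B)%MS /\ forall i, `|l 0 i| <= 1].

Lemma cube_section0 (m : nat) (B : 'M[R]_(m, n)) : cube_section B 0.
Proof. by split=> [|i]; rewrite ?sub0mx // mxE normr0 ler01. Qed.

Lemma compact_cube_section (m : nat) (B : 'M[R]_(m, n)) : compact (cube_section B).
Proof.
have -> : cube_section B =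
    [set l | (l <= B)%MS] `&` [set l | forall i, `[-1, 1]%classic (l 0 i)].
  by apply/seteqP; split=> l [lB l1]; split=> // i; have := l1 i;
    rewrite /= in_itv /= ler_norml.
rewrite setIC; apply: compact_closedI; last exact: closed_row_space.
apply: (@rV_compact R n (fun=> `[-1, 1]%classic)) => i; exact: segment_compact.
Qed.

End CubeSection.

Lemma expR_le_quadratic (R : realType) (u : R) :
  u <= 2^-1 -> expR u <= 1 + u + 2 * u ^+ 2.
Proof.
move=> u_le.
have : expR u * (1 - u) <= 1.
  by rewrite -[leRHS](expRxMexpNx_1 u) ler_wpM2l ?expR_ge0 ?expR_ge1Dx.
have : 0 <= u ^+ 2 * (1 - 2 * u) by rewrite mulr_ge0 ?sqr_ge0 //; lra.
by move=> *; rewrite -(ler_pM2r (_ : 0 < 1 - u)); lra.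
Qed.

Lemma near0N (R : realType) (P : set R) :
  (\forall s \near 0, P s) -> \forall s \near 0, P (- s).
Proof.
move=> nearP; have : - s @[s --> (0 : R)] --> - (0 : R).
  by apply: cvgN; exact: cvg_id.
by rewrite oppr0; apply.
Qed.

Section TiltedSum.
Variables (R : realType) (I : finType) (A : {set I}) (p a : I -> R) (c : R).
Hypothesis p_ge0 : forall v, v \in A -> 0 <= p v.
Implicit Types s : R.

Definition tilted_sum s := \sum_(v in A) p v * expR (s * a v - s ^+ 2 * c).

Lemma tilted_sum0 : tilted_sum 0 = \sum_(v in A) p v.
Proof. by apply: eq_bigr => v _; rewrite expr0n /= !mul0r subr0 expR0 mulr1. Qed.

(* Adding up the increments [s] and [- s] cancels the first-order terms. *)
Lemma tilted_sum_symmetric_le s :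
  s != 0 ->
  (forall v, s * a v - s ^+ 2 * c <= 2^-1) ->
  (forall v, - s * a v - (- s) ^+ 2 * c <= 2^-1) ->
  tilted_sum 0 <= tilted_sum s -> tilted_sum 0 <= tilted_sum (- s) ->
  (c - 2 * s ^+ 2 * c ^+ 2) * \sum_(v in A) p v <= 2 * \sum_(v in A) p v * a v ^+ 2.
Proof.
move=> s_neq0 small smallN; rewrite tilted_sum0.
set M := \sum_(v in A) p v; set Q := \sum_(v in A) _ * _ => increase increaseN.
have : tilted_sum s + tilted_sum (- s) <=
    (2 - 2 * s ^+ 2 * c + 4 * s ^+ 4 * c ^+ 2) * M + 4 * s ^+ 2 * Q.
  rewrite !mulr_sumr -!big_split /=; apply: ler_sum => v /p_ge0 pv.
  have := ler_wpM2l pv (expR_le_quadratic (small v)).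
  have := ler_wpM2l pv (expR_le_quadratic (smallN v)); lra.
have s2_gt0 : 0 < 2 * s ^+ 2 by rewrite mulr_gt0 // exprn_even_gt0.
by move=> *; rewrite -(ler_pM2l s2_gt0); lra.
Qed.

Lemma tilted_sum_second_order :
  (\forall s \near 0, tilted_sum 0 <= tilted_sum s) ->
  c * \sum_(v in A) p v <= 2 * \sum_(v in A) p v * a v ^+ 2.
Proof.
move=> min0.
have small : \forall s \near (0 : R), forall v, s * a v - s ^+ 2 * c <= 2^-1.
  apply: (filter_forall (nbhs_filter (0 : R))) => v.
  have /cvgr_le : s * a v - s ^+ 2 * c @[s --> (0 : R)] --> 0 * a v - 0 ^+ 2 * c.
    apply: cvgB; apply: cvgM; [exact: cvg_id | exact: cvg_cst | | exact: cvg_cst].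
    exact: exprn_continuous.
  by apply; rewrite expr0n /= !mul0r subr0.
have limit : (c - 2 * s ^+ 2 * c ^+ 2) * \sum_(v in A) p v @[s --> 0^'] -->
    (c - 2 * 0 ^+ 2 * c ^+ 2) * \sum_(v in A) p v.
  apply: cvgM; last exact: cvg_cst.
  apply: cvgB; first exact: cvg_cst.
  apply: cvgM; last exact: cvg_cst.
  apply: cvgM; first exact: cvg_cst.
  by apply: cvg_within_filter; exact: exprn_continuous.
have -> : c = c - 2 * 0 ^+ 2 * c ^+ 2 by rewrite expr0n mulr0 mul0r subr0.
apply: (cvgr_to_le limit); near=> s; apply: tilted_sum_symmetric_le.
- by near: s; exact: nbhs_dnbhs_neq.
- by near: s; exact: nbhs_dnbhs.
- by near: s; apply: nbhs_dnbhs; exact: near0N small.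
- by near: s; exact: nbhs_dnbhs.
- by near: s; apply: nbhs_dnbhs; exact: near0N min0.
Unshelve. all: end_near. Qed.

End TiltedSum.

Lemma exists_row_space_vanishing_on (R : fieldType) (m n : nat) (B : 'M[R]_(m, n))
    (T : {set 'I_n}) :
  exists2 B' : 'M[R]_n, (\rank B <= \rank B' + #|T|)%N &
    forall e : 'rV[R]_n, (e <= B')%MS ->
      (e <= B)%MS /\ forall i, i \in T -> e 0 i = 0.
Proof.
pose C : 'M[R]_(n, #|T|) := colsub enum_val 1%:M.
exists (B :&: kermx C)%MS; first exact: mxrank_leq_cap_kermx.
move=> e; rewrite sub_capmx => /andP[eB /sub_kermxP eC]; split=> // i iT.
have /rowP/(_ (enum_rank_in iT i)) := eC.
by rewrite mulmx_colsub mulmx1 !mxE enum_rankK_in.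
Qed.

Section PartialColoring.
Variables (R : realType) (m n : nat) (B : 'M[R]_(m, n)).
Variables (I : finType) (A : {set I}) (y : I -> 'rV[R]_n) (eta C : R).
Implicit Types l e : 'rV[R]_n.

Definition weight l v := expR (eta * dot l (y v) - C * dot l l).

Definition potential l := \sum_(v in A) weight l v.

Definition potential_minimizer l : Prop :=
  cube_section B l /\ forall l', cube_section B l' -> potential l <= potential l'.

Definition frozen l := [set i | `|l 0 i| == 1]%SET.

Definition tilt l v := eta *: y v - (2 * C) *: l.

Lemma exists_potential_minimizer : exists l, potential_minimizer l.
Proof.
have potential_continuous : continuous potential.
  apply: continuous_big => [x|v _ l]; first exact: add_continuous.
  apply: continuous_comp; last exact: continuous_expR.
  apply: continuousB; apply: continuousM; try exact: cst_continuous.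
    by apply: continuous_dot => [?|]; [exact: cvg_id | exact: cst_continuous].
  by apply: continuous_dot => ?; exact: cvg_id.
have [||l lB lmin] := EVT_min_rV (f := potential) _ (compact_cube_section (B := B)).
- by exists 0; exact: cube_section0.
- exact: continuous_subspaceT.
by exists l; split=> [|l' l'B]; [exact: set_mem | exact/lmin/mem_set].
Qed.

Lemma potential_line l e s :
  potential (l + s *: e) =
  tilted_sum A (weight l) (fun v => dot e (tilt l v)) (C * dot e e) s.
Proof.
apply: eq_bigr => v _; rewrite -expRD; congr expR.
rewrite !(dotDl, dotBr, dotDr, dotZl, dotZr) (dotC l e); ring.
Qed.

Lemma near0_cube_section l e :
  cube_section B l -> (e <= B)%MS -> (forall i, i \in frozen l -> e 0 i = 0) ->
  \forall s \near 0, cube_section B (l + s *: e).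
Proof.
move=> [lB l1] eB e_frozen.
have : \forall s \near (0 : R), forall i, `|l 0 i + s * e 0 i| <= 1.
  apply: (filter_forall (nbhs_filter (0 : R))) => i.
  have [/e_frozen ->|] := boolP (i \in frozen l).
    by near=> s; rewrite mulr0 addr0.
  rewrite inE => l_neq1.
  have : l 0 i + s * e 0 i @[s --> (0 : R)] --> l 0 i + 0 * e 0 i.
    apply: cvgD; first exact: cvg_cst.
    by apply: cvgM; [exact: cvg_id | exact: cvg_cst].
  rewrite mul0r addr0 => /cvgr_norm_le; apply.
  by rewrite lt_neqAle l_neq1 l1.
apply: filterS => s le1; split=> [|i]; first by rewrite addmx_sub // scalemx_sub.
by rewrite !mxE.
Unshelve. all: end_near. Qed.

Lemma potential_minimizer_second_order l e :
  potential_minimizer l -> (e <= B)%MS -> (forall i, i \in frozen l -> e 0 i = 0) ->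
  C * dot e e * potential l <= 2 * \sum_(v in A) weight l v * dot e (tilt l v) ^+ 2.
Proof.
move=> [lB lmin] eB e_frozen.
apply: tilted_sum_second_order => [v _|]; first exact: expR_ge0.
apply: filterS (near0_cube_section lB eB e_frozen) => s /lmin.
by rewrite -{1}[l]addr0 -{1}(scale0r e) !potential_line.
Qed.

Lemma potential_gt0 l : (0 < #|A|)%N -> 0 < potential l.
Proof.
case/card_gt0P => v vA; rewrite /potential (bigD1 v) //=.
by rewrite ltr_pwDl ?expR_gt0 // sumr_ge0 // => w _; exact: expR_ge0.
Qed.

Hypothesis y_le : forall v, v \in A -> dot (y v) (y v) <= n%:R.

Lemma tilt_energy_le l : cube_section B l ->
  \sum_(v in A) weight l v * dot (tilt l v) (tilt l v) <=
    2 * (eta ^+ 2 + 4 * C ^+ 2) * n%:R * potential l.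
Proof.
move=> [_ l1]; rewrite mulr_sumr; apply: ler_sum => v vA.
rewrite mulrC ler_wpM2r ?expR_ge0 //.
apply: le_trans (dot_selfB_le _ _) _; rewrite !dotZl !dotZr.
have := ler_wpM2l (sqr_ge0 eta) (y_le vA).
have := ler_wpM2l (sqr_ge0 C) (dot_self_le_dim l1); lra.
Qed.

Hypothesis A_gt0 : (0 < #|A|)%N.
Hypothesis C_gt0 : 0 < C.
Hypothesis C_large : 8 * (eta ^+ 2 + 4 * C ^+ 2) * n%:R <= C * (\rank B)%:R.

Lemma rank_le_frozen l : potential_minimizer l -> (\rank B <= 2 * #|frozen l|)%N.
Proof.
move=> lmin; rewrite leqNgt; apply/negP => few_frozen.
have [B' rankB' B'_sub] := exists_row_space_vanishing_on B (frozen l).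
have rank_lt : (\rank B < 2 * \rank B')%N.
  by move: few_frozen rankB'; set t := #|frozen l|; lia.
have rankB'_gt0 : (0 < \rank B' <= \rank B')%N by lia.
have [v _|e [eB' e_neq0 e_small]] :=
  exists_direction_le_trace (A := A) (p := weight l) (tilt l) _ rankB'_gt0.
  exact: expR_ge0.
have [eB e_frozen] := B'_sub e eB'.
have : (\rank B')%:R * C * (dot e e * potential l) <=
    4 * (eta ^+ 2 + 4 * C ^+ 2) * n%:R * (dot e e * potential l).
  have := ler_wpM2l (dot_self_ge0 e) (tilt_energy_le lmin.1).
  have := potential_minimizer_second_order lmin eB e_frozen.
  by move=> /(ler_wpM2l (ler0n R (\rank B'))); lra.
rewrite ler_pM2r ?mulr_gt0 ?dot_self_gt0 ?potential_gt0 //.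
by move: C_large rank_lt; rewrite -(ltr_nat R) natrM -(ltr_pM2l C_gt0); lra.
Qed.

Lemma exists_partial_coloring :
  exists l, [/\ cube_section B l, (\rank B)%:R <= 2 * dot l l &
    forall v, v \in A -> weight l v <= #|A|%:R].
Proof.
have [l lmin] := exists_potential_minimizer; exists l; split=> [||v vA].
- exact: lmin.1.
- apply: le_trans (_ : 2 * #|frozen l|%:R <= _).
    by rewrite -natrM ler_nat rank_le_frozen.
  by rewrite ler_pM2l // card_le_dot_self // => i; rewrite inE => /eqP.
apply: (@le_trans _ _ (potential l)).
  by rewrite /potential (bigD1 v) //= lerDl sumr_ge0 // => w _; exact: expR_ge0.
apply: le_trans (lmin.2 0 (cube_section0 B)) _.
rewrite /potential -sumr_const; apply: ler_sum => w _.
by rewrite /weight !dot0l !mulr0 subr0 expR0.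
Qed.

End PartialColoring.

Lemma expR_le_card_support (R : realType) (m n : nat) (B : 'M[R]_(m, n))
    (I : finType) (A : {set I}) (y : I -> 'rV[R]_n) (rho b : R) :
  0 < rho <= 1 -> 0 < b -> b * n%:R <= (\rank B)%:R ->
  (forall v, v \in A -> dot (y v) (y v) <= n%:R) ->
  (forall l, cube_section B l ->
    exists2 v, v \in A & rho * dot l l <= dot l (y v)) ->
  expR (rho ^+ 2 * b ^+ 2 / 128 * n%:R) <= #|A|%:R.
Proof.
move=> /andP[rho_gt0 rho_le1] b_gt0 dimB y_le support.
(* [C = eta rho / 2]: at a supporting vector the exponent is at least [C |l|^2]. *)
pose eta := rho * b / 32; pose C := rho ^+ 2 * b / 64.
have A_gt0 : (0 < #|A|)%N.
  by have [v vA _] := support 0 (cube_section0 B); apply/card_gt0P; exists v.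
have C_gt0 : 0 < C by rewrite divr_gt0 // mulr_gt0 // exprn_gt0.
have C_large : 8 * (eta ^+ 2 + 4 * C ^+ 2) * n%:R <= C * (\rank B)%:R.
  have : C * (b * n%:R) <= C * (\rank B)%:R by rewrite ler_pM2l.
  have : 8 * (eta ^+ 2 + 4 * C ^+ 2) <= C * b.
    have -> : 8 * (eta ^+ 2 + 4 * C ^+ 2) = C * b * ((1 + rho ^+ 2) / 2).
      by rewrite /eta /C; field.
    rewrite ler_piMr ?(mulr_ge0 (ltW C_gt0) (ltW b_gt0)) //.
    have : rho ^+ 2 <= 1 by rewrite expr_le1 // ltW.
    lra.
  by move=> /(ler_wpM2r (ler0n R n)); lra.
have [l [lB l_large weight_le]] :=
  exists_partial_coloring y_le A_gt0 C_gt0 C_large.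
have [v vA lv] := support l lB.
apply: le_trans (weight_le v vA); rewrite ler_expR.
have := ler_wpM2l (ltW C_gt0) (le_trans dimB l_large).
have eta_ge0 : 0 <= eta by rewrite divr_ge0 // mulr_ge0 // ltW.
by have := ler_wpM2l eta_ge0 lv; rewrite /eta /C; lra.
Qed.

Section Faces.
Variables (R : realType) (n : nat).
Implicit Types (P F G : set 'rV[R]_n) (x l : 'rV[R]_n).

Lemma face_subset P F : is_face P F -> F `<=` P.
Proof. by move=> [c [d [_ ->]]] y []. Qed.

Lemma is_faceI P F G : is_face P F -> is_face P G -> is_face P (F `&` G).
Proof.
move=> [c [a [ca ->]]] [d [b [db ->]]]; exists (c + d), (a + b).
have cdE (y : 'rV[R]_n) : \sum_i (c + d) 0 i * y 0 i = dot c y + dot d y.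
  exact: dotDl.
split=> [y Py|]; first by rewrite cdE lerD ?ca ?db.
apply/seteqP; split=> y /=; rewrite cdE; first by move=> [[Py <-] [_ <-]].
move=> [Py sumE]; have := ca y Py; have := db y Py; rewrite -/(dot c y) -/(dot d y).
by move=> *; do !split=> //; lra.
Qed.

Lemma minimal_face_subset P F G x :
  is_minimal_face_containing P x F -> is_face P G -> G x -> F `<=` G.
Proof.
move=> [faceF Fx minF] faceG Gx.
have FG : F `&` G = F by apply: minF => [|//|y []//]; exact: is_faceI.
by rewrite -FG => y [].
Qed.

Lemma face_midpoint P F x l :
  is_face P F -> F x -> P (x + l) -> P (x - l) -> F (x + l).
Proof.
move=> [c [d [cd ->]]] [_ cx] Pxl /cd back_ge; split=> //.
move: (cd _ Pxl) cx back_ge => /=.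
by rewrite -!/(dot c _) dotBr dotDr; lra.
Qed.

End Faces.

Section ConvHull.
Variables (R : realType) (n : nat) (S : {set 'rV[bool]_n}).
Implicit Types (u y : 'rV[R]_n) (F : set 'rV[R]_n).

Lemma conv_hull_cube_point s : s \in S -> conv_hull R S (cube_point R s).
Proof.
move=> sS; exists (fun s' => (s' == s)%:R); split=> //.
  by rewrite (bigD1 s) //= eqxx big1 ?addr0 // => s' /andP[_ /negbTE ->].
rewrite (bigD1 s) //= eqxx scale1r big1 ?addr0 // => s' /andP[_ /negbTE ->].
by rewrite scale0r.
Qed.

Lemma conv_hull_ge0_le1 y i : conv_hull R S y -> 0 <= y 0 i <= 1.
Proof.
move=> [w [w0 w1 ->]]; rewrite summxE -w1.
by apply/andP; split; [apply: sumr_ge0 | apply: ler_sum] => s /w0 ws;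
  rewrite !mxE; case: (s 0 i); rewrite ?mulr1 ?mulr0.
Qed.

Lemma conv_hull_support u y :
  conv_hull R S y -> exists2 s, s \in S & dot u y <= dot u (cube_point R s).
Proof.
move=> [w [w0 w1 yE]]; apply: contrapT => no_s.
have lt_y s : s \in S -> dot u (cube_point R s) < dot u y.
  by move=> sS; rewrite ltNge; apply/negP => y_le; apply: no_s; exists s.
have gap0 : \sum_(s in S) w s * (dot u y - dot u (cube_point R s)) = 0.
  under eq_bigr do rewrite mulrBr.
  by rewrite sumrB -mulr_suml w1 mul1r -dot_lincombr -yE subrr.
have gap_ge0 s : s \in S -> 0 <= w s * (dot u y - dot u (cube_point R s)).
  by move=> sS; rewrite mulr_ge0 ?w0 // subr_ge0 ltW ?lt_y.
have /eqP := oner_neq0 R; rewrite -w1; apply; apply: big1 => s sS.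
have /eqP := psumr_eq0P gap_ge0 gap0 sS.
by rewrite mulf_eq0 subr_eq0 (gt_eqF (lt_y s sS)) orbF => /eqP.
Qed.

Lemma face_conv_hull F : is_face (conv_hull R S) F ->
  F `<=` conv_hull R [set s in S | cube_point R s \in F]%SET.
Proof.
move=> [c [d [cd FE]]] y Fy; move: (Fy); rewrite {1}FE => -[[w [w0 w1 yE]] cy].
have gap0 : \sum_(s in S) w s * (dot c (cube_point R s) - d) = 0.
  under eq_bigr do rewrite mulrBr.
  by rewrite sumrB -mulr_suml w1 mul1r -dot_lincombr -yE [dot c y]cy subrr.
have gap_ge0 s : s \in S -> 0 <= w s * (dot c (cube_point R s) - d).
  by move=> sS; rewrite mulr_ge0 ?w0 // subr_ge0; apply/cd/conv_hull_cube_point.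
have off_face s : s \in S -> cube_point R s \notin F -> w s = 0.
  move=> sS sF; have /eqP := psumr_eq0P gap_ge0 gap0 sS.
  rewrite mulf_eq0 subr_eq0 => /orP[/eqP //|/eqP cs]; case/negP: sF.
  by rewrite inE FE; split; first exact: conv_hull_cube_point.
have restrict (V : nmodType) (g : 'rV[bool]_n -> V) :
    (forall s, w s = 0 -> g s = 0) ->
    \sum_(s in [set s in S | cube_point R s \in F]%SET) g s = \sum_(s in S) g s.
  move=> g0; rewrite [RHS](bigID (fun s => cube_point R s \in F)) /=.
  rewrite [X in _ + X]big1 ?addr0 => [|s /andP[sS sF]].
    by apply: eq_bigl => s; rewrite finset.in_set.
  by rewrite g0 ?off_face.
exists w; split; last by rewrite restrict // => s ->; rewrite scale0r.
  by move=> s; rewrite finset.in_set => /andP[/w0].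
by rewrite restrict.
Qed.

End ConvHull.

Section AffineDim.
Variables (R : realType) (n : nat).

Lemma affinely_independent_row_free k (p : 'I_k.+1 -> 'rV[R]_n) :
  affinely_independent p ->
  row_free (\matrix_(i < k) (p (lift ord0 i) - p ord0)).
Proof.
move=> indep; apply/inj_row_free => v vB.
pose c (i : 'I_k.+1) : R := if unlift ord0 i is Some j then v 0 j else - \sum_j v 0 j.
have c0 : c ord0 = - \sum_j v 0 j by rewrite /c unlift_none.
have cS (j : 'I_k) : c (lift ord0 j) = v 0 j by rewrite /c liftK.
apply/rowP => j; rewrite mxE -cS; apply: indep.
  by rewrite big_ord_recl c0 [X in _ + X](eq_bigr (v 0)) ?addNr.
rewrite big_ord_recl c0.
under [X in _ + X]eq_bigr do rewrite cS.
rewrite scaleNr scaler_suml addrC -sumrB -[RHS]vB mulmx_sum_row.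
by apply: eq_bigr => i _; rewrite rowK scalerBr.
Qed.

Lemma affine_dim_attained (A : set 'rV[R]_n) : A !=set0 ->
  exists p : 'I_(affine_dim A).+1 -> 'rV[R]_n,
    (forall i, A (p i)) /\ affinely_independent p.
Proof.
move=> [x Ax]; pose D := [pred k : 'I_n.+1 |
  `[< exists p : 'I_k.+1 -> 'rV[R]_n,
        (forall i, A (p i)) /\ affinely_independent p >]].
have D_gt0 : (0 < #|D|)%N.
  apply/card_gt0P; exists ord0; apply/asboolP; exists (fun=> x); split=> // c.
  by rewrite big_ord1 => c0 _ i; rewrite (ord1 i).
have [k /asboolP kD kE] := eq_bigmax_cond (fun k : 'I_n.+1 => k : nat) D_gt0.
by have -> : affine_dim A = k by rewrite -kE.
Qed.

End AffineDim.

Section GscGeometry.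
Variables (R : realType) (n : nat).
Implicit Types (I J : {set 'I_n}) (y : 'rV[R]_n).

Definition gsc_normal I J : 'rV[R]_n := \row_i ((i \in I)%:R - (i \in J)%:R).

Lemma dot_gsc_normal I J y :
  dot (gsc_normal I J) y = \sum_(i in I) y 0 i - \sum_(j in J) y 0 j.
Proof.
rewrite [\sum_(i in I) _]big_mkcond [\sum_(j in J) _]big_mkcond -sumrB.
by apply: eq_bigr => i _; rewrite mxE mulrBl; do 2![case: ifP => _];
  rewrite ?mul1r ?mul0r.
Qed.

Lemma gsc_sumE I J y :
  \sum_(i in I) y 0 i + \sum_(j in J) (1 - y 0 j) =
  #|J|%:R + dot (gsc_normal I J) y.
Proof. by rewrite dot_gsc_normal sumrB sumr_const addrCA. Qed.

Lemma gsc_holdsE I J y :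
  gsc_holds I J y = (1 - #|J|%:R <= dot (gsc_normal I J) y).
Proof. by rewrite /gsc_holds gsc_sumE lerBlDl. Qed.

Lemma norm_dot_gsc_normal_le I J y (r : R) :
  (forall i, `|y 0 i| <= r) -> `|dot (gsc_normal I J) y| <= (#|I| + #|J|)%:R * r.
Proof.
move=> yr; rewrite dot_gsc_normal natrD mulrDl.
by apply: le_trans (ler_normB _ _) _; apply: lerD;
  apply: le_trans (ler_norm_sum _ _ _) _;
  rewrite mulr_natl -sumr_const; apply: ler_sum.
Qed.

End GscGeometry.

Lemma sum_two_values (R : pzRingType) (T : finType) (A : {set T}) (f : T -> R)
    (u v : R) : (forall i, f i = u \/ f i = v) ->
  exists b : nat, \sum_(i in A) f i = #|A|%:R * u + b%:R * (v - u).
Proof.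
move=> fuv; exists (\sum_(i in A) (f i != u))%N.
rewrite natr_sum mulr_suml mulr_natl -sumr_const -big_split /=.
apply: eq_bigr => i _; case: eqVneq => [->|/eqP fu]; first by rewrite mul0r addr0.
by case: (fuv i) => // ->; rewrite mul1r addrCA subrr addr0.
Qed.

Definition slack_rate (R : unitRingType) (lambda : nat) : R :=
  (lambda * lambda.+1)%:R^-1.

Lemma slack_rate_gt0_le1 (R : realFieldType) (lambda : nat) :
  (0 < lambda)%N -> 0 < slack_rate R lambda <= 1.
Proof.
by move=> lambda_gt0; rewrite invr_gt0 invf_le1 ltr0n ?ler1n muln_gt0 lambda_gt0.
Qed.

(* [v] is a sum of [k] terms in {1 / lambda, 1 - 1 / lambda}, of which [b] are equal
   to 1 - 1 / lambda. *)
Lemma two_valued_sum_slack (R : realFieldType) (lambda k b : nat) :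
  (3 <= lambda <= k)%N ->
  let v : R := k%:R * lambda%:R^-1 + b%:R * (1 - lambda%:R^-1 - lambda%:R^-1) in
  v = 1 \/ 1 + k%:R * slack_rate R lambda <= v.
Proof.
move=> /andP[lambda3 lambda_k] v; set L : R := lambda%:R in v *.
have L3 : 3 <= L by rewrite ler_nat.
have kL : L <= k%:R by rewrite ler_nat.
have vE :
    v - k%:R * slack_rate R lambda = k%:R / (L + 1) + b%:R * (1 - L^-1 - L^-1).
  by rewrite /v /slack_rate natrM -natr1 -/L; field; apply/andP; split; lra.
suff : v = 1 \/ 1 <= k%:R / (L + 1) + b%:R * (1 - L^-1 - L^-1).
  by case=> [|slack]; [left | right; rewrite -lerBrDr vE].
have [b0|b_gt0] := posnP b.
  rewrite /v b0 mul0r !addr0; have [k_gt|k_le] := ltnP lambda k.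
    right; rewrite ler_pdivlMr; last lra.
    by rewrite mul1r natr1 ler_nat.
  left; have -> : k = lambda by apply/eqP; rewrite eqn_leq k_le.
  by rewrite divff //; lra.
have Linv : L^-1 + L^-1 <= k%:R / (L + 1).
  rewrite ler_pdivlMr; last lra.
  have : L^-1 * L = 1 by rewrite mulVf //; lra.
  have : 0 < L^-1 by rewrite invr_gt0; lra.
  nra.
have : 1 - L^-1 - L^-1 <= b%:R * (1 - L^-1 - L^-1).
  rewrite ler_peMl ?ler1n //.
  have : L^-1 <= 3^-1 by rewrite lef_pV2 ?posrE; lra.
  lra.
by right; lra.
Qed.

Section CubeIdeal.
Variables (R : realType) (n lambda : nat) (S : {set 'rV[bool]_n}) (x : 'rV[R]_n).
Hypothesis lambda_ge3 : (3 <= lambda)%N.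
Hypothesis x_val : forall i, x 0 i = lambda%:R^-1 \/ x 0 i = 1 - lambda%:R^-1.
Hypothesis S_ideal : cube_ideal R S.
Hypothesis S_conn : connectivity R S = (lambda%:R)%:E.
Implicit Types (I J : {set 'I_n}) (l : 'rV[R]_n).

Let rho : R := slack_rate R lambda.

Lemma gsc_tight_or_slack I J : (lambda <= #|I| + #|J|)%N ->
  dot (gsc_normal R I J) x = 1 - #|J|%:R \/
  1 - #|J|%:R + (#|I| + #|J|)%:R * rho <= dot (gsc_normal R I J) x.
Proof.
move=> lambda_le.
have [a aE] := sum_two_values I x_val.
have [b bE] : exists b : nat, \sum_(j in J) (1 - x 0 j) =
    #|J|%:R * lambda%:R^-1 + b%:R * (1 - lambda%:R^-1 - lambda%:R^-1).
  apply: sum_two_values => j.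
  by case: (x_val j) => ->; [right | left; rewrite subKr].
have := gsc_sumE I J x; rewrite aE bE addrACA -!mulrDl -!natrD => sumE.
have bounds : (3 <= lambda <= #|I| + #|J|)%N by rewrite lambda_ge3.
have := two_valued_sum_slack R (a + b) bounds.
by rewrite /= sumE -/rho => -[tight|slack]; [left | right]; lra.
Qed.

Lemma gsc_valid_card I J :
  [disjoint I & J]%B -> gsc_valid R S I J -> (lambda <= #|I| + #|J|)%N.
Proof.
move=> disjIJ validIJ; rewrite -(ler_nat R) -lee_fin -S_conn /connectivity.
by apply: (bigmin_le_cond _ (j := (I, J))); rewrite disjIJ; apply/asboolP.
Qed.

Definition tight_direction l : Prop :=
  forall I J, [disjoint I & J]%B -> gsc_valid R S I J ->
    dot (gsc_normal R I J) x = 1 - #|J|%:R -> dot (gsc_normal R I J) l = 0.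

Lemma conv_hull_perturb l :
  (forall i, `|l 0 i| <= rho) -> tight_direction l -> conv_hull R S (x + l).
Proof.
move=> l_small l_tight; have [m [e hullE]] := S_ideal; rewrite hullE => k /=.
have valid_k y : conv_hull R S y -> cube_ineq_holds (e k) y by rewrite hullE; apply.
have lambda_gt0 : (0 < lambda)%N := ltnW (ltnW lambda_ge3).
have rho_le : rho <= lambda%:R^-1.
  by rewrite lef_pV2 ?posrE ?ltr0n ?muln_gt0 ?lambda_gt0 // ler_nat leq_pmulr.
have lambdaV : lambda%:R^-1 <= 3^-1 :> R.
  by rewrite lef_pV2 ?posrE ?ltr0n // ler_nat.
have x_bounds i : lambda%:R^-1 <= x 0 i <= 1 - lambda%:R^-1.
  by case: (x_val i) => ->; apply/andP; split; lra.
have xl_bounds i : 0 <= (x + l) 0 i <= 1.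
  have := l_small i; rewrite mxE ler_norml; move: (x_bounds i).
  by move=> /andP[? ?] /andP[? ?]; apply/andP; split; lra.
case: (e k) valid_k => [i|i|I J disjIJ] valid_k /=.
- by case/andP: (xl_bounds i).
- by case/andP: (xl_bounds i).
rewrite gsc_holdsE dotDr.
have [tight|slack] := gsc_tight_or_slack (gsc_valid_card disjIJ valid_k).
  by rewrite tight l_tight // addr0.
have := norm_dot_gsc_normal_le I J l_small; rewrite ler_norml => /andP[? _]; lra.
Qed.

Lemma face_perturb (F : set 'rV[R]_n) l : is_face (conv_hull R S) F -> F x ->
  (forall i, `|l 0 i| <= rho) -> tight_direction l -> F (x + l).
Proof.
move=> faceF Fx l_small l_tight; apply: (face_midpoint faceF Fx).
  exact: conv_hull_perturb.
apply: conv_hull_perturb => [i|I J disjIJ validIJ tight].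
  by rewrite mxE normrN.
by rewrite dotNr l_tight // oppr0.
Qed.

Lemma minimal_face_tight_direction (F : set 'rV[R]_n) p q :
  is_minimal_face_containing (conv_hull R S) x F -> F p -> F q ->
  tight_direction (p - q).
Proof.
move=> minF Fp Fq I J disjIJ validIJ tight.
pose G := [set y | conv_hull R S y /\ dot (gsc_normal R I J) y = 1 - #|J|%:R].
have faceG : is_face (conv_hull R S) G.
  exists (gsc_normal R I J), (1 - #|J|%:R); split=> // y /validIJ.
  by rewrite gsc_holdsE.
have Gx : G x by case: minF => faceF Fx _; split=> //; exact: (face_subset faceF).
have FG := minimal_face_subset minF faceG Gx.
have [[_ Gp] [_ Gq]] := (FG p Fp, FG q Fq).
by rewrite dotBr Gp Gq subrr.
Qed.

Lemma tight_direction_row_space (m : nat) (B : 'M[R]_(m, n)) l :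
  (forall i, tight_direction (row i B)) -> (l <= B)%MS -> tight_direction l.
Proof.
move=> tightB /submxP[a ->] I J disjIJ validIJ tight.
by rewrite mulmx_sum_row dot_lincombr big1 // => i _; rewrite tightB ?mulr0.
Qed.

Lemma minimal_face_cube_section (F : set 'rV[R]_n) :
  is_minimal_face_containing (conv_hull R S) x F ->
  exists B : 'M[R]_(affine_dim F, n), row_free B /\
    forall l, cube_section B l -> F (x + rho *: l).
Proof.
move=> minF; have [faceF Fx _] := minF.
have [p [pF indep]] : exists p : 'I_(affine_dim F).+1 -> 'rV[R]_n,
    (forall i, F (p i)) /\ affinely_independent p.
  by apply: affine_dim_attained; exists x.
exists (\matrix_i (p (lift ord0 i) - p ord0)); split.
  exact: affinely_independent_row_free.
move=> l [lB l1]; apply: face_perturb => // [i|].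
  by rewrite mxE normrM ger0_norm ?ler_piMr ?invr_ge0.
apply: tight_direction_row_space (scalemx_sub _ lB) => i; rewrite rowK.
exact: minimal_face_tight_direction minF (pF _) (pF _).
Qed.

End CubeIdeal.

Theorem theorem1p2 (R : realType) (lambda : nat) (beta : R)
    (hlambda : (3 <= lambda)%N) (hbeta : 0 < beta <= 1) :
  exists theta : R, 0 < theta /\
    forall (n : nat) (S : {set 'rV[bool]_n}) (x : 'rV[R]_n) (F : set 'rV[R]_n),
      cube_ideal R S ->
      connectivity R S = (lambda%:R)%:E ->
      (forall i, x 0 i = lambda%:R^-1 \/ x 0 i = 1 - lambda%:R^-1) ->
      is_minimal_face_containing (conv_hull R S) x F ->
      beta * n%:R <= (affine_dim F)%:R ->
      expR (theta * n%:R) <=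
        (#|[set s in S | cube_point R s \in F]%SET|)%:R.
Proof.
have /andP[beta_gt0 _] := hbeta.
have rho_bounds := @slack_rate_gt0_le1 R lambda (ltnW (ltnW hlambda)).
set rho := slack_rate R lambda in rho_bounds; have /andP[rho_gt0 _] := rho_bounds.
exists (rho ^+ 2 * beta ^+ 2 / 128); split.
  by rewrite divr_gt0 // mulr_gt0 // exprn_gt0.
move=> n S x F S_ideal S_conn x_val minF dimF; have [faceF Fx _] := minF.
have [B [/eqP rankB section_F]] :=
  minimal_face_cube_section hlambda x_val S_ideal S_conn minF.
apply: (@expR_le_card_support _ _ _ B _ _ (fun s => cube_point R s - x)) => //.
- by rewrite rankB.
- move=> s _; apply: dot_self_le_dim => i.
  have := conv_hull_ge0_le1 i (face_subset faceF Fx); rewrite !mxE ler_norml.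
  by case: (s 0 i) => /=; lra.
move=> l /section_F/(face_conv_hull faceF)/(conv_hull_support l)[s sF support_le].
by exists s => //; move: support_le; rewrite dotBr dotDr dotZr -/rho; lra.
Qed.
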